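(* Let $T=(V,E)$ be a combinatorial tree, and assume $|V|\ge 3$. Let $\{i,j\}\in E$ be a fixed edge. (i) If $\{i,j\}$ is not a leaf edge and $\alpha\in[0,1)$, then $$0\ge \kappa^{\mathsf{or},\alpha}_{ij}\ge \kappa^{\mathsf{lly}}_{ij}>\max_{x\in\{i,j\}}\left\{\frac{4}{\mathrm{d}(x)}\left(\kappa^{\mathsf{s}}_x-\frac12\right)\right\}.$$ (ii) If $i$ is a leaf node and $\alpha\in[0,1)$ is such that $1+\frac{1}{\mathrm{d}(j)}\le\frac{1}{1-\alpha}$ (for example, $\alpha\ge\frac12$ suffices), then $$0\le \kappa^{\mathsf{or},\alpha}_{ij}\le \kappa^{\mathsf{lly}}_{ij}\le \frac{8}{3}\kappa^{\mathsf{s}}_i.$$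
   Context: A tree is a finite, simple, connected, acyclic graph; a combinatorial tree is a tree with all edge weights equal to one. A node is a leaf if it has exactly one neighbor; an edge is a leaf edge if it is incident to a leaf. Write $V=\{1,\dots,n\}$, $n=|V|$, $i\sim j$ if $\{i,j\}\in E$, and $\mathrm{d}(i)$ for the degree of $i$ (number of incident edges). $\Delta(i,j)$ is the shortest path distance (number of edges in a shortest path), and $\mathcal{D}\in\mathbb{R}^{n\times n}$ is the matrix with $\mathcal{D}_{ij}=\Delta(i,j)$. For $\alpha\in[0,1)$ and $i\in V$, the $\alpha$-lazy random walk measure $m_i^{(\alpha)}$ is the probability measure on $V$ with $m_i^{(\alpha)}(i)=\alpha$, $m_i^{(\alpha)}(x)=(1-\alpha)/\mathrm{d}(i)$ if $x\sim i$, and $m_i^{(\alpha)}(x)=0$ otherwise. For probability measures $\mu,\nu$ on $V$, the 1-Wasserstein distance is $$\mathsf{W}_1(\mu,\nu)=\inf\Big\{\sum_{i,j\in V}\pi_{ij}\Delta(i,j):\ \pi\in\mathbb{R}^{n\times n},\ \pi_{ij}\ge 0,\ \mathbf{1}^T\pi=\mu^T,\ \pi\mathbf{1}=\nu\Big\},$$ where $\mathbf 1$ is the all-ones vector. Ollivier-Ricci curvature: $\kappa^{\mathsf{or},\alpha}_{ij}=1-\mathsf{W}_1(m_i^{(\alpha)},m_j^{(\alpha)})/\Delta(i,j)$ for $i\ne j$. Lin-Lu-Yau curvature: $\kappa^{\mathsf{lly}}_{ij}=\lim_{\alpha\to1^-}\kappa^{\mathsf{or},\alpha}_{ij}/(1-\alpha)$.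 Steinerberger curvature: $\kappa^{\mathsf{s}}=\mathcal{D}^{+}(n\mathbf{1})\in\mathbb{R}^n$, with $\kappa^{\mathsf{s}}_i$ its $i$-th entry, where $\mathcal{D}^+$ is the Moore-Penrose inverse. *)

(* Defs.v *)
From HB Require Import structures.
From mathcomp Require Import all_boot all_order all_algebra.
From mathcomp Require Import all_classical all_reals all_analysis.

Set Implicit Arguments.
Unset Strict Implicit.
Unset Printing Implicit Defensive.

Import Order.TTheory GRing.Theory Num.Theory.
Import numFieldNormedType.Exports.

Local Open Scope classical_set_scope.
Local Open Scope ring_scope.

Section Graph.
Variable n : nat.
Implicit Types (e : rel 'I_n) (i j x : 'I_n).

Definition simple_graph e : Prop := symmetric e /\ irreflexive e.

Definition connected_graph e : Prop := forall i j, connect e i j.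

(* The bound [2 < size s] is needed: in a symmetric relation every edge [i j]
   gives a [cycle] [:: i; j], and the empty sequence is a [cycle]. *)
Definition acyclic_graph e : Prop :=
  forall s : seq 'I_n, (2 < size s)%N -> ~ ucycle e s.

Definition is_tree e : Prop :=
  [/\ simple_graph e, connected_graph e & acyclic_graph e].

Definition degree e i : nat := #|[set j | e i j]%SET|.

Definition is_leaf e i : bool := degree e i == 1%N.

Definition is_leaf_edge e i j : bool := is_leaf e i || is_leaf e j.

(* Shortest paths repeat no vertex, so their length is less than [n]; the
   value is [n] when [i] and [j] are not connected. *)
Definition gdist e i j : nat :=
  \big[minn/n]_(k < n | [exists p : k.-tuple 'I_n,
                           path e i p && (last i p == j)]) k.

Lemma gdist_le e i (p : seq 'I_n) :
  path e i p -> (gdist e i (last i p) <= size p)%N.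
Proof.
move=> ep; case: (shortenP ep) => q eq uq sub.
have sq : (size q < n)%N.
  by have := max_card [in i :: q]; rewrite (card_uniqP uq) card_ord.
have le_qp : (size q <= size p)%N.
  by apply: uniq_leq_size sub; case/andP: uq.
apply: leq_trans le_qp; rewrite /gdist.
rewrite (_ : size q = Ordinal sq :> nat) //.
apply: (@bigmin_le_cond _ nat _ n (Ordinal sq) _ (@nat_of_ord n)).
by apply/existsP; exists (in_tuple q); rewrite /= eq eqxx.
Qed.

Lemma gdist_path e i j : connect e i j ->
  exists p, [/\ path e i p, last i p = j & size p = gdist e i j].
Proof.
move=> /connectP[p ep ->]; set y := last i p.
pose K m := m = n \/ exists p, [/\ path e i p, last i p = y & size p = m].
have : K (gdist e i y).
  apply: (big_ind K) => [|a b Ka Kb|k]; first by left.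
    by rewrite /minn; case: ifP.
  move=> /existsP[q /andP[eq /eqP lq]]; right; exists q.
  by rewrite size_tuple.
case=> // dn.
have [q [eq lq uq]] : exists q, [/\ path e i q, last i q = y & uniq (i :: q)].
  by rewrite /y; case: (shortenP ep) => q eq uq _; exists q.
have sq : (size q < n)%N.
  by have := max_card [in i :: q]; rewrite (card_uniqP uq) card_ord.
by have := gdist_le eq; rewrite lq dn leqNgt sq.
Qed.

End Graph.

Section MoorePenrose.
Variable R : realType.

Definition is_moore_penrose (m n : nat) (A : 'M[R]_(m, n))
    (X : 'M[R]_(n, m)) : Prop :=
  [/\ A *m X *m A = A, X *m A *m X = X,
      (A *m X)^T = A *m X & (X *m A)^T = X *m A].

Definition moore_penrose (m n : nat) (A : 'M[R]_(m, n)) : 'M[R]_(n, m) :=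
  xget 0 [set X | is_moore_penrose A X].

Lemma moore_penrose_uniq (m n : nat) (A : 'M[R]_(m, n)) X Y :
  is_moore_penrose A X -> is_moore_penrose A Y -> X = Y.
Proof.
move=> [x1 x2 x3 x4] [y1 y2 y3 y4].
have AXY : A *m X = A *m Y.
  by rewrite -x3 -[in LHS]y1 -[A *m Y *m A *m X]mulmxA trmx_mul x3 y3 mulmxA x1.
have XAY : X *m A = Y *m A.
  rewrite -x4 -[in LHS]y1 !mulmxA -[X *m A *m Y *m A]mulmxA trmx_mul y4 x4.
  by rewrite -mulmxA (mulmxA A X A) x1.
by rewrite -x2 XAY -mulmxA AXY mulmxA y2.
Qed.

Lemma gram_unitmx (m n : nat) (B : 'M[R]_(m, n)) :
  row_free B -> B *m B^T \in unitmx.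
Proof.
move=> fB; rewrite -row_free_unit; apply: inj_row_free => v vBB.
have vB0 : v *m B = 0.
  have : (v *m B) *m (v *m B)^T = 0.
    by rewrite trmx_mul mulmxA -(mulmxA v) vBB mul0mx.
  move: (v *m B) => w /matrixP/(_ ord0 ord0); rewrite !mxE => /eqP.
  rewrite psumr_eq0 => [/allP s0|k _]; last by rewrite mxE -expr2 sqr_ge0.
  apply/rowP => k; have := s0 k (mem_index_enum k).
  by rewrite mxE -expr2 sqrf_eq0 => /eqP ->; rewrite mxE.
by apply/eqP; rewrite -(mulmx_free_eq0 _ fB) vB0.
Qed.

Lemma moore_penroseP (m n : nat) (A : 'M[R]_(m, n)) :
  is_moore_penrose A (moore_penrose A).
Proof.
apply: xgetPex.
have [r [C [B [-> fC fB]]]] :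
  exists (r : nat) (C : 'M[R]_(m, r)) (B : 'M[R]_(r, n)),
    [/\ A = C *m B, row_free C^T & row_free B].
  exists (\rank A), (col_base A), (row_base A); split.
  - by rewrite mulmx_base.
  - by rewrite /row_free mxrank_tr; exact: col_base_full.
  - exact: row_base_free.
have uB := gram_unitmx fB; have := gram_unitmx fC; rewrite trmxK => uC.
pose B' := B^T *m invmx (B *m B^T); pose C' := invmx (C^T *m C) *m C^T.
have BB' : B *m B' = 1%:M by rewrite mulmxA mulmxV.
have C'C : C' *m C = 1%:M by rewrite -mulmxA mulVmx.
have AX : C *m B *m (B' *m C') = C *m C'.
  by rewrite mulmxA -(mulmxA C) BB' mulmx1.
have XA : B' *m C' *m (C *m B) = B' *m B.
  by rewrite mulmxA -(mulmxA B') C'C mulmx1.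
exists (B' *m C'); split.
- by rewrite AX mulmxA -(mulmxA C) C'C mulmx1.
- by rewrite XA mulmxA -(mulmxA B') BB' mulmx1.
- by rewrite AX /C' !trmx_mul trmx_inv trmx_mul !trmxK mulmxA.
- by rewrite XA /B' !trmx_mul trmx_inv trmx_mul !trmxK mulmxA.
Qed.

End MoorePenrose.

Section Curvature.
Variables (R : realType) (n : nat).
Implicit Types (e : rel 'I_n) (i j x : 'I_n) (mu nu : 'cV[R]_n) (alpha : R).

Definition dist_mx e : 'M[R]_n := \matrix_(i, j) (gdist e i j)%:R.

Definition lazy_walk e alpha i : 'cV[R]_n :=
  \col_x (if x == i then alpha
          else if e i x then (1 - alpha) / (degree e i)%:R else 0).

Definition transport_plan mu nu (pi : 'M[R]_n) : Prop :=
  [/\ forall i j, 0 <= pi i j,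
      (const_mx 1 : 'rV[R]_n) *m pi = mu^T &
      pi *m (const_mx 1 : 'cV[R]_n) = nu].

Definition wasserstein1 e mu nu : R :=
  inf [set \sum_i \sum_j pi i j * (gdist e i j)%:R
      | pi in [set pi | transport_plan mu nu pi]].

Definition kappa_or e alpha i j : R :=
  1 - wasserstein1 e (lazy_walk e alpha i) (lazy_walk e alpha j)
      / (gdist e i j)%:R.

Definition kappa_lly e i j : R :=
  lim (kappa_or e alpha i j / (1 - alpha) @[alpha --> (1 : R)^'-]).

Definition kappa_s e : 'cV[R]_n :=
  moore_penrose (dist_mx e) *m (n%:R *: const_mx 1).

End Curvature.

(* Main.v *)
Require Import Defs.
From HB Require Import structures.
From mathcomp Require Import all_boot all_order all_algebra.
From mathcomp Require Import all_classical all_reals all_analysis.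
From mathcomp Require Import zify ring lra.
Import Order.TTheory GRing.Theory Num.Theory.
Import numFieldNormedType.Exports.
Local Open Scope ring_scope.

(** For adjacent vertices [i], [j] of a tree let [p = (1 - alpha) / deg i] and
    [q = (1 - alpha) / deg j]. Everything follows from two closed formulas.

    Ollivier-Ricci curvature. Removing the edge between [i] and [j] leaves two
    components, and the signed height [edge_potential], which grows from the
    component of [i] towards that of [j], is 1-Lipschitz. It certifies as
    optimal any transport plan that moves mass only upwards. Between the two
    balls, the only move that is not upwards is from [j] to [i], and a coupling
    of the two walks without this move exists as soon as [p + q <= 1]
    ([coupling_avoiding_pair]). Hence in this regime [W1] is a difference of
    two integrals of the height, and [kappa_or_edge] gives
      kappa_or = (1 - alpha) * (2 / deg i + 2 / deg j - 2).
    As [alpha] tends to 1 the condition [p + q <= 1] holds eventually, so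
    [kappa_lly] is the second factor ([kappa_lly_edge]). The condition also
    holds for every [alpha] if neither end is a leaf, and if [i] is a leaf it
    is the assumption made on [alpha].

    Steinerberger curvature. Every vertex other than the root [r] has exactly
    one neighbour nearer to [r], all others being farther by one
    ([neighbour_gdist]). Double counting over the edges then yields the
    Graham-Lovasz inverse of the distance matrix [D] and the identity
    [D *m tau = (n - 1) *: 1] with [tau x = 2 - deg x]. So the Moore-Penrose
    inverse is the inverse, and [kappa_s_tree] gives
      kappa_s x = n / (n - 1) * (2 - deg x).

    What remains is arithmetic with degrees: they are at least 2 at both ends
    in the first part, and [deg i = 1] in the second. *)

(** * Graph distance *)

Section GraphMetric.
Context {n : nat} {e : rel 'I_n}.
Hypothesis e_sym : symmetric e.
Hypothesis e_conn : connected_graph e.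
Implicit Types x y z r : 'I_n.

Lemma gdist_geodesic x y :
  exists p, [/\ path e x p, last x p = y & size p = gdist e x y].
Proof. exact/gdist_path/e_conn. Qed.

Lemma gdistxx x : gdist e x x = 0%N.
Proof. by apply/eqP; have := @gdist_le _ e x [::] isT; rewrite /= leqn0. Qed.

Lemma gdist_eq0 x y : (gdist e x y == 0%N) = (x == y).
Proof.
apply/eqP/eqP => [d0|->]; last exact: gdistxx.
by have [p [_ lp]] := gdist_geodesic x y; rewrite d0 -lp => /size0nil ->.
Qed.

Lemma gdist_triangle x y z :
  (gdist e x z <= gdist e x y + gdist e y z)%N.
Proof.
have [p [ep lp <-]] := gdist_geodesic x y.
have [q [eq lq <-]] := gdist_geodesic y z.
have epq : path e x (p ++ q) by rewrite cat_path ep lp.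
by have := gdist_le epq; rewrite last_cat lp lq size_cat.
Qed.

Lemma gdistC x y : gdist e x y = gdist e y x.
Proof.
suff le a b : (gdist e a b <= gdist e b a)%N by apply/eqP; rewrite eqn_leq !le.
have [p [ep <- <-]] := gdist_geodesic b a.
have erev : path e (last b p) (rev (belast b p)).
  by rewrite rev_path; apply: sub_path ep => u v; rewrite e_sym.
have := gdist_le erev; rewrite size_rev size_belast.
suff -> : last (last b p) (rev (belast b p)) = b by [].
by case: p {ep erev} => //= c p; rewrite rev_cons last_rcons.
Qed.

Lemma gdist_edge_le r x y : e x y -> (gdist e r y <= (gdist e r x).+1)%N.
Proof.
move=> exy; apply: leq_trans (gdist_triangle r x y) _.
have exy1 : path e x [:: y] by rewrite /= exy.
by rewrite -addn1 leq_add2l; have := gdist_le exy1.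
Qed.

(** The first step of a geodesic. *)
Lemma gdist_step r x : x != r ->
  exists2 y, e x y & (gdist e r y).+1 = gdist e r x.
Proof.
move=> xr; have [[|y p] /= [ep lp sp]] := gdist_geodesic x r.
  by rewrite lp eqxx in xr.
case/andP: ep => exy ep; exists y => //; apply/eqP; rewrite eqn_leq.
rewrite gdist_edge_le 1?e_sym // andbT [gdist e r x]gdistC -sp ltnS gdistC.
by have := gdist_le ep; rewrite lp.
Qed.

(** Adding up the increments of [f] along a geodesic. *)
Lemma edge_lipschitz (R : numDomainType) (f : 'I_n -> R) :
  (forall x y, e x y -> f y - f x <= 1) ->
  forall x y, f y - f x <= (gdist e x y)%:R.
Proof.
move=> fe x y; have [p [ep <- <-]] := gdist_geodesic x y.
elim: p x ep => [|z p IH] x /=; first by rewrite subrr.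
move=> /andP[exz ep]; rewrite -(subrKA (f z)) -natr1.
by rewrite lerD ?IH ?fe.
Qed.

End GraphMetric.

(** * Distances in trees *)

Section TreeMetric.
Context {n : nat} {e : rel 'I_n}.
Hypothesis e_tree : is_tree e.
Implicit Types x y z r : 'I_n.

Let e_sym : symmetric e. Proof. by case: e_tree => -[]. Qed.
Let e_irr : irreflexive e. Proof. by case: e_tree => -[]. Qed.
Let e_conn : connected_graph e. Proof. by case: e_tree. Qed.
Let e_acyc : acyclic_graph e. Proof. by case: e_tree. Qed.

Lemma gdist_edge x y : e x y -> gdist e x y = 1%N.
Proof.
move=> exy; apply/eqP; rewrite eqn_leq.
have := gdist_edge_le e_conn x _ _ exy; rewrite gdistxx => -> /=.
rewrite lt0n gdist_eq0 //.
by apply: contraTneq exy => ->; rewrite e_irr.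
Qed.

(** A geodesic from [y] to [r] through [x] would make [x] nearer to [r]. *)
Lemma path_avoid r x y : y != x -> (gdist e r y <= gdist e r x)%N ->
  exists2 p, path e y p & last y p = r /\ x \notin y :: p.
Proof.
move=> yx le_yx; have [p [ep lp sp]] := gdist_geodesic e_conn y r.
exists p => //; split=> //; rewrite inE negb_or eq_sym yx /=.
apply/negP => xp; case/splitPr: xp => p1 p2 in ep lp sp.
move: ep lp; rewrite cat_path last_cat /= => /and3P[_ _ ep2] lp2.
have := gdist_le ep2; rewrite lp2 => le2.
move: sp; rewrite size_cat /= (gdistC e_sym e_conn y) => sp.
by move: le_yx; rewrite -sp (gdistC e_sym e_conn r); lia.
Qed.

(** Two such neighbours [y] and [z] would both be joined to [r] by geodesics
    that avoid [x]; gluing these gives a path from [y] to [z] off [x], which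
    [x] closes up into a cycle. *)
Lemma parent_unique r x y z : e x y -> e x z ->
  (gdist e r y <= gdist e r x)%N -> (gdist e r z <= gdist e r x)%N -> y = z.
Proof.
move=> exy exz ley lez; apply/eqP/negPn/negP => yz.
have nx w : e x w -> w != x by apply: contraTneq => ->; rewrite e_irr.
have [p ep [lp xp]] := path_avoid _ _ _ (nx _ exy) ley.
have [q eq [lq xq]] := path_avoid _ _ _ (nx _ exz) lez.
pose q' := rev (belast z q).
have eq' : path e r q'.
  by rewrite -lq rev_path; apply: sub_path eq => u v; rewrite e_sym.
have lq' : last r q' = z.
  rewrite /q'; case: q {eq xq q' eq'} lq => [//|c q] _ /=.
  by rewrite rev_cons last_rcons.
have epq : path e y (p ++ q') by rewrite cat_path ep lp.
have lpq : last y (p ++ q') = z by rewrite last_cat lp.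
have xpq : x \notin y :: (p ++ q').
  rewrite -cat_cons mem_cat negb_or xp /= mem_rev.
  by apply: contra xq => /mem_belast.
case: (shortenP epq) lpq => s es us sub lz.
have xs : x \notin y :: s.
  apply: contra xpq; rewrite !inE => /predU1P[->|/sub ->]; last by rewrite orbT.
  by rewrite eqxx.
apply: (e_acyc (x :: y :: s)).
  by case: s {es us sub xs} lz => //= yz'; rewrite yz' eqxx in yz.
rewrite /ucycle cons_uniq xs us /cycle /= exy rcons_path es /=.
by rewrite lz e_sym exz.
Qed.

Lemma neighbour_gdist r x : x != r ->
  exists y, [/\ e x y, (gdist e r y).+1 = gdist e r x &
    forall z, e x z -> z != y -> gdist e r z = (gdist e r x).+1].
Proof.
move=> xr; have [y exy dy] := gdist_step e_sym e_conn _ _ xr.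
exists y; split=> // z exz zy; apply/eqP; rewrite eqn_leq.
rewrite (gdist_edge_le e_conn r _ _ exz) ltnNge; apply: contra zy => lez.
by apply/eqP/(parent_unique r x) => //; rewrite -dy.
Qed.

(** Trees are bipartite, so the ends of an edge are never equidistant. *)
Lemma gdist_parity r x y : e x y ->
  gdist e r y = (gdist e r x).+1 \/ gdist e r x = (gdist e r y).+1.
Proof.
move=> exy; have [xr|xr] := eqVneq x r.
  by left; rewrite xr gdistxx gdist_edge // -xr.
have [z [exz dz dother]] := neighbour_gdist r x xr.
have [->|yz] := eqVneq y z; first by right.
by left; apply: dother.
Qed.

(** Seen from [y], both [j] and the first vertex after [i] on the geodesic
    from [i] to [x] are closer than [i], so they coincide; but that vertex is
    nearer to [x] than [i], while [j] is farther. Thus the only edge joining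
    the side of [i] to the side of [j] is the one between [i] and [j]. *)
Lemma crossing_edge i j x y : e i j -> e x y ->
  (gdist e i x < gdist e j x)%N -> (gdist e j y < gdist e i y)%N ->
  gdist e i x = 0%N /\ gdist e j y = 0%N.
Proof.
move=> eij exy ltx lty.
have dC := gdistC e_sym e_conn.
have dx := gdist_parity x i j eij; have dy := gdist_parity y i j eij.
rewrite !(dC x) in dx; rewrite !(dC y) in dy.
have di := gdist_parity i x y exy; have dj := gdist_parity j x y exy.
have [ix|ix] := eqVneq i x.
  have dix : gdist e i x = 0%N by rewrite ix gdistxx.
  by lia.
have [k [eik dk _]] := neighbour_gdist x i ix.
have lek : (gdist e y k <= gdist e y i)%N.
  have := gdist_edge_le e_conn k _ _ exy.
  by rewrite (dC y k) (dC k x) (dC y i); move: dk; rewrite (dC x i); lia.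
have lej : (gdist e y j <= gdist e y i)%N by rewrite !(dC y); lia.
have kj := parent_unique y i k j eik eij lek lej.
by move: dk; rewrite kj !(dC x); lia.
Qed.

End TreeMetric.

(** * The distance matrix of a tree *)

Section DistanceMatrix.
Context {R : realType} {n : nat} {e : rel 'I_n}.
Hypothesis e_tree : is_tree e.
Implicit Types x y z r : 'I_n.

Let e_sym : symmetric e. Proof. by case: e_tree => -[]. Qed.
Let e_conn : connected_graph e. Proof. by case: e_tree. Qed.

Local Notation d x := ((degree e x)%:R : R).
Local Notation D x y := ((gdist e x y)%:R : R).

Lemma sum_neighbours_const x (c : R) : \sum_(y | e x y) c = d x * c.
Proof. by rewrite sumr_const mulr_natl /degree cardsE. Qed.

(** All neighbours of [x] count as children, up to a correction for the one
    parent, which only the root lacks. *)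
Lemma sum_neighbours_gdist (F : nat -> R) r x :
  \sum_(y | e x y) F (gdist e r y) = d x * F (gdist e r x).+1
    - (if x == r then 0 else F (gdist e r x).+1 - F (gdist e r x).-1).
Proof.
rewrite -sum_neighbours_const; case: eqVneq => [->|xr].
  by rewrite subr0 gdistxx; apply: eq_bigr => y exy; rewrite gdist_edge.
have [y [exy dy dother]] := neighbour_gdist e_tree r x xr.
rewrite (bigD1 y) //= [in RHS](bigD1 y) //= -dy /= dy.
have -> : \sum_(z | e x z && (z != y)) F (gdist e r z)
        = \sum_(z | e x z && (z != y)) F (gdist e r x).+1.
  by apply: eq_bigr => z /andP[exz zy]; rewrite dother.
ring.
Qed.

Lemma double_count_neighbours (g : 'I_n -> R) :
  \sum_x \sum_(y | e x y) g y = \sum_y d y * g y.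
Proof.
rewrite (exchange_big_dep xpredT) //=; apply: eq_bigr => y _.
by rewrite -sum_neighbours_const; apply: eq_bigl => x; rewrite e_sym.
Qed.

Lemma sum_neighbours_dist r x :
  \sum_(y | e x y) D r y = d x * (D r x + 1) - 2 + 2 * (x == r)%:R.
Proof.
rewrite (sum_neighbours_gdist (fun k => k%:R)).
have [->|xr] := eqVneq x r; first by rewrite gdistxx ?eqxx /=; ring.
have : (0 < gdist e r x)%N by rewrite lt0n gdist_eq0 // eq_sym.
by case: (gdist e r x) => // k _ /=; rewrite -!natr1; ring.
Qed.

Lemma sum_neighbours_dist_sqr r x :
  \sum_(y | e x y) D r y ^+ 2 = d x * (D r x + 1) ^+ 2 - 4 * D r x.
Proof.
rewrite (sum_neighbours_gdist (fun k => k%:R ^+ 2)).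
have [->|xr] := eqVneq x r; first by rewrite gdistxx ?eqxx /=; ring.
have : (0 < gdist e r x)%N by rewrite lt0n gdist_eq0 // eq_sym.
by case: (gdist e r x) => // k _ /=; rewrite -!natr1; ring.
Qed.

Lemma sum_indicator_eq r : \sum_x (x == r)%:R = 1 :> R.
Proof.
by rewrite (bigD1 r) //= eqxx big1 ?addr0 // => x /negbTE ->.
Qed.

Lemma sum_degree : (0 < n)%N -> \sum_x d x = 2 * (n%:R - 1).
Proof.
move=> n0; pose r := Ordinal n0.
have := double_count_neighbours (fun y => D r y).
under eq_bigr do rewrite sum_neighbours_dist mulrDr mulr1.
rewrite !big_split /= sumr_const card_ord -mulr_sumr sum_indicator_eq.
by rewrite -mulr_natr; lra.
Qed.

(** Each edge [{x, y}] contributes the squared distance of [y] for [x] and of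
    [x] for [y]. Evaluating this double sum with [sum_neighbours_dist_sqr], the
    quadratic terms cancel and a linear relation between the distances is
    left. *)
Lemma sum_dist_tau r : \sum_y D r y * (2 - d y) = n%:R - 1.
Proof.
have n0 : (0 < n)%N by apply: leq_ltn_trans (ltn_ord r).
have := double_count_neighbours (fun y => D r y ^+ 2).
have -> : \sum_x \sum_(y | e x y) D r y ^+ 2
    = \sum_x d x * D r x ^+ 2 + \sum_x d x - 2 * \sum_x D r x * (2 - d x).
  rewrite mulr_sumr -big_split /= -sumrB; apply: eq_bigr => x _.
  by rewrite sum_neighbours_dist_sqr; ring.
by rewrite sum_degree //; lra.
Qed.

(** The inverse of the distance matrix of a tree found by Graham and Lovasz:
    minus half the Laplacian plus a matrix of rank one. *)
Definition graham_lovasz_mx : 'M[R]_n :=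
  \matrix_(a, b) ((e a b)%:R / 2 - (a == b)%:R * d a / 2
                  + (2 - d a) * (2 - d b) / (2 * (n%:R - 1))).

Lemma graham_lovasz_mulmx : (1 < n)%N ->
  graham_lovasz_mx *m dist_mx R e = 1%:M.
Proof.
move=> n1; have n1' : n%:R - 1 != 0 :> R by rewrite subr_eq0 pnatr_eq1; lia.
apply/matrixP => a b; rewrite !mxE.
under eq_bigr => c _ do
  rewrite !mxE [gdist e c b](gdistC e_sym e_conn) 2!mulrDl.
rewrite !big_split /=.
have -> : \sum_c (e a c)%:R / 2 * D b c
    = (d a * (D b a + 1) - 2 + 2 * (a == b)%:R) / 2.
  rewrite -sum_neighbours_dist mulr_suml [RHS]big_mkcond /=.
  by apply: eq_bigr => c _; case: (e a c) => /=; ring.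
have -> : \sum_c - ((a == c)%:R * d a / 2) * D b c = - (d a * D b a / 2).
  rewrite (bigD1 a) //= eqxx big1 ?addr0 => [|c ca]; first by move=> /=; ring.
  by rewrite eq_sym (negbTE ca) /=; ring.
have -> : \sum_c (2 - d a) * (2 - d c) / (2 * (n%:R - 1)) * D b c
    = (2 - d a) / 2.
  transitivity ((2 - d a) / (2 * (n%:R - 1)) * \sum_c D b c * (2 - d c)).
    by rewrite mulr_sumr; apply: eq_bigr => c _; ring.
  by rewrite sum_dist_tau; field.
by field.
Qed.

Lemma kappa_s_tree i : (1 < n)%N ->
  kappa_s R e i 0 = n%:R / (n%:R - 1) * (2 - d i).
Proof.
move=> n1; have n1' : n%:R - 1 != 0 :> R by rewrite subr_eq0 pnatr_eq1; lia.
pose y : 'cV[R]_n := \col_x (n%:R / (n%:R - 1) * (2 - d x)).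
have Dy : dist_mx R e *m y = n%:R *: const_mx 1.
  apply/colP => x; rewrite !mxE mulr1.
  transitivity (n%:R / (n%:R - 1) * \sum_z D x z * (2 - d z)).
    by rewrite mulr_sumr; apply: eq_bigr => z _; rewrite !mxE; ring.
  by rewrite sum_dist_tau; field.
have [DXD _ _ _] := moore_penroseP (dist_mx R e).
rewrite /kappa_s -Dy mulmxA.
have -> : moore_penrose (dist_mx R e) *m dist_mx R e = 1%:M.
  rewrite -[LHS]mul1mx -(graham_lovasz_mulmx n1) -mulmxA.
  by rewrite [dist_mx R e *m _]mulmxA DXD.
by rewrite mul1mx mxE.
Qed.

End DistanceMatrix.

(** * Optimal transport on a graph *)

Section OptimalTransport.
Context {R : realType} {n : nat}.
Implicit Types (mu nu : 'cV[R]_n) (e : rel 'I_n) (x y : 'I_n).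

Lemma transport_plan_col mu nu pi x :
  transport_plan mu nu pi -> \sum_y pi y x = mu x 0.
Proof.
case=> _ /rowP/(_ x) + _; rewrite !mxE => <-.
by apply: eq_bigr => y _; rewrite mxE mul1r.
Qed.

Lemma transport_plan_row mu nu pi y :
  transport_plan mu nu pi -> \sum_x pi y x = nu y 0.
Proof.
case=> _ _ /colP/(_ y); rewrite !mxE => <-.
by apply: eq_bigr => x _; rewrite mxE mulr1.
Qed.

Lemma transport_plan_potential mu nu pi (f : 'I_n -> R) :
  transport_plan mu nu pi ->
  \sum_y \sum_x pi y x * (f y - f x)
    = \sum_y f y * nu y 0 - \sum_x f x * mu x 0.
Proof.
move=> pl; under eq_bigr do under eq_bigr do rewrite mulrBr.
under eq_bigr do rewrite sumrB.
rewrite sumrB; congr (_ - _).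
  apply: eq_bigr => y _; rewrite -(transport_plan_row _ _ _ _ pl) mulr_sumr.
  by apply: eq_bigr => x _; rewrite mulrC.
rewrite exchange_big /=; apply: eq_bigr => x _.
rewrite -(transport_plan_col _ _ _ _ pl) mulr_sumr.
by apply: eq_bigr => y _; rewrite mulrC.
Qed.

Lemma transport_plan_support mu nu pi y x :
  transport_plan mu nu pi -> pi y x != 0 -> mu x 0 != 0 /\ nu y 0 != 0.
Proof.
move=> pl pyx; have pi0 a b : 0 <= pi a b by case: pl.
rewrite -(transport_plan_col _ _ _ x pl) -(transport_plan_row _ _ _ y pl).
split; apply: contra pyx; rewrite psumr_eq0 => // /allP s0.
  exact: s0 (mem_index_enum y).
exact: s0 (mem_index_enum x).
Qed.

(** Kantorovich duality with complementary slackness: [f] bounds the cost of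
    every plan from below, and [pi] attains this bound. *)
Lemma wasserstein1_optimal e mu nu pi (f : 'I_n -> R) :
  (forall x y, f y - f x <= (gdist e y x)%:R) ->
  transport_plan mu nu pi ->
  (forall y x, pi y x != 0 -> (gdist e y x)%:R <= f y - f x) ->
  wasserstein1 e mu nu = \sum_y f y * nu y 0 - \sum_x f x * mu x 0.
Proof.
move=> f_lip pl slack; rewrite /wasserstein1.
set S := image _ _; set v := RHS.
have Sv : S v.
  exists pi => //; rewrite /v -(transport_plan_potential _ _ _ _ pl).
  apply: eq_bigr => y _; apply: eq_bigr => x _.
  have [->|pi0] := eqVneq (pi y x) 0; first by rewrite !mul0r.
  by congr (_ * _); apply: le_anti; rewrite slack // f_lip.
have Slb : lbound S v.
  move=> _ [pi' pl' <-]; rewrite /v -(transport_plan_potential _ _ _ _ pl').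
  apply: ler_sum => y _; apply: ler_sum => x _.
  by rewrite ler_wpM2l ?f_lip //; case: pl'.
apply: le_anti; rewrite ge_inf //=; last by exists v.
by rewrite lb_le_inf //; exists v.
Qed.

(** The mass that [mu] has at [j] is spread over the targets other than [i] in
    proportion to [nu], and the mass that [nu] wants at [i] is drawn from the
    sources other than [j] in proportion to [mu]. What is left on both sides
    is [1 - mu j - nu i], hence the last bound; it is coupled as a product. *)
Lemma coupling_avoiding_pair mu nu i j :
  (forall x, 0 <= mu x 0) -> (forall y, 0 <= nu y 0) ->
  \sum_x mu x 0 = 1 -> \sum_y nu y 0 = 1 ->
  0 < mu j 0 -> 0 < nu i 0 -> mu j 0 + nu i 0 <= 1 ->
  exists2 pi, transport_plan mu nu pi & pi i j = 0.
Proof.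
move=> mu0 nu0 mu1 nu1; set p := mu j 0; set q := nu i 0 => p0 q0 pq.
have p1 : 1 - p != 0 by lra.
have q1 : 1 - q != 0 by lra.
pose pi : 'M[R]_n := \matrix_(y, x)
  (if y == i then if x == j then 0 else q * mu x 0 / (1 - p)
   else if x == j then p * nu y 0 / (1 - q)
   else mu x 0 * nu y 0 * (1 - p - q) / ((1 - p) * (1 - q))).
have sum_mu : \sum_(x | x != j) mu x 0 = 1 - p.
  by rewrite -mu1 [in RHS](bigD1 j) //= -/p; ring.
have sum_nu : \sum_(y | y != i) nu y 0 = 1 - q.
  by rewrite -nu1 [in RHS](bigD1 i) //= -/q; ring.
exists pi; last by rewrite mxE !eqxx.
split=> [y x||].
- rewrite mxE; case: ifP => _; case: ifP => _ //.
  + by rewrite !mulr_ge0 ?invr_ge0 //; lra.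
  + by rewrite !mulr_ge0 ?invr_ge0 //; lra.
  + by rewrite !mulr_ge0 ?invr_ge0 ?mulr_ge0 //; lra.
- apply/rowP => x; rewrite !mxE.
  under eq_bigr do rewrite !mxE mul1r.
  rewrite (bigD1 i) //= eqxx.
  under eq_bigr => y yi do rewrite (negbTE yi).
  have [->|xj] := eqVneq x j.
    by rewrite -mulr_suml -mulr_sumr sum_nu -/p; field.
  by rewrite -!mulr_suml -mulr_sumr sum_nu; field; rewrite ?p1 ?q1.
- apply/colP => y; rewrite !mxE.
  under eq_bigr do rewrite !mxE mulr1.
  rewrite (bigD1 j) //= eqxx.
  under eq_bigr => x xj do rewrite (negbTE xj).
  have [->|yi] := eqVneq y i.
    by rewrite -mulr_suml -mulr_sumr sum_mu -/q; field.
  by rewrite -!mulr_suml sum_mu; field; rewrite ?p1 ?q1.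
Qed.

End OptimalTransport.

(** * Curvature of an edge of a tree *)

Lemma degree_gt0 {n : nat} {e : rel 'I_n} {x y : 'I_n} :
  e x y -> (0 < degree e x)%N.
Proof.
by move=> exy; rewrite /degree card_gt0; apply/set0Pn; exists y; rewrite inE.
Qed.

Section EdgeCurvature.
Context {R : realType} {n : nat} {e : rel 'I_n}.
Hypothesis e_tree : is_tree e.
Context {i j : 'I_n}.
Hypothesis eij : e i j.
Implicit Types (x y : 'I_n) (alpha : R).

Let e_sym : symmetric e. Proof. by case: e_tree => -[]. Qed.
Let e_irr : irreflexive e. Proof. by case: e_tree => -[]. Qed.
Let e_conn : connected_graph e. Proof. by case: e_tree. Qed.
Let dC := gdistC e_sym e_conn.
Let eji : e j i. Proof. by rewrite e_sym. Qed.
Let ij_neq : i != j. Proof. by apply: contraTneq eij => ->; rewrite e_irr. Qed.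

Local Notation d x := ((degree e x)%:R : R).

(** Delete the edge between [i] and [j]. On any simple path from the component
    of [i] to that of [j], which has to pass through [i] and then [j], this is
    the signed position with origin [i]. *)
Definition edge_potential x : R :=
  if (gdist e i x < gdist e j x)%N then - (gdist e i x)%:R
  else 1 + (gdist e j x)%:R.

Lemma gdist_ends x :
  gdist e j x = (gdist e i x).+1 \/ gdist e i x = (gdist e j x).+1.
Proof. by rewrite ![gdist e _ x]dC; apply: gdist_parity. Qed.

(** The only edge where the two formulas for the height meet is the edge from
    [i] to [j], by [crossing_edge], and there the height grows by one. *)
Lemma edge_potential_lipschitz x y :
  edge_potential y - edge_potential x <= (gdist e y x)%:R.
Proof.
rewrite (dC y); apply: edge_lipschitz => // {}x {}y exy.
rewrite /edge_potential.
have := gdist_edge_le e_conn j _ _ exy.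
have := gdist_edge_le e_conn i y x; rewrite e_sym exy => /(_ isT).
case: ifP => lty; case: ifP => ltx; rewrite -!(ler_nat R) -!natr1.
- lra.
- move=> _ _.
  have := ler0n R (gdist e i y); have := ler0n R (gdist e j x); lra.
- have lty' : (gdist e j y < gdist e i y)%N by case: (gdist_ends y) lty; lia.
  by have [-> ->] := crossing_edge e_tree i j x y eij exy ltx lty'; lra.
- lra.
Qed.

Lemma sum_lazy_walk (f : 'I_n -> R) alpha x :
  \sum_y f y * lazy_walk e alpha x y 0
    = alpha * f x + (1 - alpha) / d x * \sum_(y | e x y) f y.
Proof.
rewrite (bigD1 x) //= mxE eqxx mulrC; congr (_ + _).
rewrite mulr_sumr [LHS]big_mkcond [RHS]big_mkcond; apply: eq_bigr => y _.
by rewrite mxE; case: eqVneq => [->|_] /=; rewrite ?e_irr //;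
   case: ifP => _; ring.
Qed.

Lemma lazy_walk_ge0 alpha x y : 0 <= alpha -> alpha < 1 ->
  0 <= lazy_walk e alpha x y 0.
Proof.
move=> a0 a1; rewrite mxE; case: ifP => // _; case: ifP => // _.
by rewrite divr_ge0 ?ler0n //; lra.
Qed.

Lemma lazy_walk_support alpha x y : lazy_walk e alpha x y 0 != 0 ->
  y = x \/ e x y.
Proof.
rewrite mxE; case: (eqVneq y x) => [->|_]; first by left.
by case: ifP; [right|rewrite eqxx].
Qed.

Lemma edge_potential_i : edge_potential i = 0.
Proof.
by rewrite /edge_potential gdistxx (gdist_edge e_tree _ _ eji) oppr0.
Qed.

Lemma edge_potential_j : edge_potential j = 1.
Proof. by rewrite /edge_potential gdistxx addr0. Qed.

Lemma edge_potential_nbr_i x : e i x -> x != j -> edge_potential x = -1.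
Proof.
move=> eix xj; rewrite /edge_potential (gdist_edge e_tree _ _ eix).
have [->|dj] := gdist_ends x; first by rewrite (gdist_edge e_tree _ _ eix).
suff jx : j == x by rewrite eq_sym jx in xj.
rewrite -(gdist_eq0 e_conn); move: dj; rewrite (gdist_edge e_tree _ _ eix); lia.
Qed.

Lemma edge_potential_nbr_j y : e j y -> y != i -> edge_potential y = 2.
Proof.
move=> ejy yi; rewrite /edge_potential (gdist_edge e_tree _ _ ejy).
have [di|->] := gdist_ends y; last first.
  by rewrite (gdist_edge e_tree _ _ ejy) /=; lra.
suff iy : i == y by rewrite eq_sym iy in yi.
rewrite -(gdist_eq0 e_conn); move: di; rewrite (gdist_edge e_tree _ _ ejy); lia.
Qed.

Lemma sum_edge_potential_i : \sum_(x | e i x) edge_potential x = 2 - d i.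
Proof.
have : \sum_(x | e i x) (1 : R) = d i by rewrite sum_neighbours_const mulr1.
rewrite (bigD1 j) //= => <-; rewrite (bigD1 j) //= edge_potential_j.
have -> : \sum_(x | e i x && (x != j)) edge_potential x
        = - \sum_(x | e i x && (x != j)) 1.
  by rewrite -sumrN; apply: eq_bigr => x /andP[]; apply: edge_potential_nbr_i.
ring.
Qed.

Lemma sum_edge_potential_j :
  \sum_(y | e j y) edge_potential y = 2 * d j - 2.
Proof.
have : \sum_(y | e j y) (1 : R) = d j by rewrite sum_neighbours_const mulr1.
rewrite (bigD1 i) //= => <-; rewrite (bigD1 i) //= edge_potential_i.
have -> : \sum_(y | e j y && (y != i)) edge_potential y
        = 2 * \sum_(y | e j y && (y != i)) 1.
  rewrite mulr_sumr; apply: eq_bigr => y /andP[ejy yi].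
  by rewrite mulr1 edge_potential_nbr_j.
ring.
Qed.

(** A unit of mass sent from the ball around [i] to the ball around [j] climbs
    in height all the way, unless it goes from [j] back to [i]. *)
Lemma edge_potential_slack x y : x = i \/ e i x -> y = j \/ e j y ->
  (y, x) != (i, j) ->
  (gdist e y x)%:R <= edge_potential y - edge_potential x.
Proof.
move=> xi yj; have [->|xj] := eqVneq x j.
  case: yj => [->|ejy]; first by rewrite gdistxx subrr.
  rewrite xpair_eqE eqxx andbT => yi.
  rewrite edge_potential_nbr_j // edge_potential_j (dC y).
  by rewrite (gdist_edge e_tree) //; lra.
move=> _; have fx : edge_potential x = - (gdist e i x)%:R.
  case: xi => [->|eix]; first by rewrite edge_potential_i gdistxx oppr0.
  by rewrite edge_potential_nbr_i // (gdist_edge e_tree).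
have fy : (gdist e y i)%:R <= edge_potential y.
  have [->|yi] := eqVneq y i; first by rewrite gdistxx edge_potential_i.
  case: yj => [->|ejy].
    by rewrite edge_potential_j (gdist_edge e_tree) //.
  rewrite edge_potential_nbr_j // (ler_nat R _ 2).
  have := gdist_triangle e_conn y j i; rewrite (dC y j).
  by rewrite (gdist_edge e_tree _ _ ejy) (gdist_edge e_tree _ _ eji).
have := gdist_triangle e_conn y i x; rewrite -(ler_nat R) natrD fx opprK.
lra.
Qed.

(** The side of [i] carries mass [1 - (1 - alpha) / d i] in the walk from [i]
    and [(1 - alpha) / d j] in the walk from [j]. The last hypothesis says that
    the net flow goes from [i] to [j], so that all mass can move upwards. *)
Lemma kappa_or_edge alpha : 0 <= alpha -> alpha < 1 ->
  (1 - alpha) / d i + (1 - alpha) / d j <= 1 ->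
  kappa_or e alpha i j = (1 - alpha) * (2 / d i + 2 / d j - 2).
Proof.
move=> a0 a1 pq.
have di0 : 0 < d i by rewrite ltr0n (degree_gt0 eij).
have dj0 : 0 < d j by rewrite ltr0n (degree_gt0 eji).
have mass x : 0 < d x -> \sum_y lazy_walk e alpha x y 0 = 1.
  move=> dx0; have := sum_lazy_walk (fun=> 1) alpha x.
  under eq_bigr do rewrite mul1r.
  rewrite sum_neighbours_const => ->; field; lra.
have mij : lazy_walk e alpha i j 0 = (1 - alpha) / d i.
  by rewrite mxE eij eq_sym (negbTE ij_neq).
have mji : lazy_walk e alpha j i 0 = (1 - alpha) / d j.
  by rewrite mxE eji (negbTE ij_neq).
have [||||||| pi pl pi0] :=
  @coupling_avoiding_pair R n (lazy_walk e alpha i) (lazy_walk e alpha j) i j.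
- by move=> x; apply: lazy_walk_ge0.
- by move=> x; apply: lazy_walk_ge0.
- exact: mass.
- exact: mass.
- by rewrite mij divr_gt0 ?subr_gt0.
- by rewrite mji divr_gt0 ?subr_gt0.
- by rewrite mij mji.
rewrite /kappa_or (gdist_edge e_tree _ _ eij) divr1.
rewrite (wasserstein1_optimal _ _ _ _ _ edge_potential_lipschitz pl).
  rewrite !sum_lazy_walk sum_edge_potential_i sum_edge_potential_j.
  rewrite edge_potential_i edge_potential_j; field; lra.
move=> y x pyx; have [mx my] := transport_plan_support _ _ _ _ _ pl pyx.
apply: edge_potential_slack; [exact: lazy_walk_support mx| |].
  exact: lazy_walk_support my.
by apply: contraNneq pyx => -[-> ->]; apply/eqP.
Qed.

Lemma kappa_lly_edge : kappa_lly R e i j = 2 / d i + 2 / d j - 2.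
Proof.
apply: cvg_lim => //; apply: (@cvg_near_cst R).
near=> alpha.
have a0 : 1 / 2 <= alpha by near: alpha; apply: nbhs_left_ge; lra.
have a1 : alpha < 1 by near: alpha; exact: nbhs_left_lt.
have half x y : e x y -> (1 - alpha) / d x <= 1 / 2.
  move=> exy; have d1 : 1 <= d x by rewrite ler1n (degree_gt0 exy).
  by rewrite ler_pdivrMr; lra.
rewrite kappa_or_edge //.
- by rewrite mulrC mulKf // subr_eq0 gt_eqF.
- lra.
- by have := half _ _ eij; have := half _ _ eji; lra.
Unshelve. all: by end_near.
Qed.

End EdgeCurvature.

Theorem theorem1p2 (R : realType) (n : nat) (e : rel 'I_n)
    (he : is_tree e) (hn : (3 <= n)%N) (i j : 'I_n) (hij : e i j) :
  (~~ is_leaf_edge e i j ->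
     forall alpha : R, 0 <= alpha -> alpha < 1 ->
       [/\ 0 >= kappa_or e alpha i j,
           kappa_or e alpha i j >= kappa_lly R e i j &
           kappa_lly R e i j >
             Num.max (4 / (degree e i)%:R * (kappa_s R e i 0 - 1 / 2))
                     (4 / (degree e j)%:R * (kappa_s R e j 0 - 1 / 2))])
  /\
  (is_leaf e i ->
     forall alpha : R, 0 <= alpha -> alpha < 1 ->
       (1 / 2 <= alpha -> 1 + 1 / (degree e j)%:R <= 1 / (1 - alpha))
       /\
       (1 + 1 / (degree e j)%:R <= 1 / (1 - alpha) ->
          [/\ 0 <= kappa_or e alpha i j,
              kappa_or e alpha i j <= kappa_lly R e i j &
              kappa_lly R e i j <= 8 / 3 * kappa_s R e i 0])).
Proof.
have eji : e j i by case: he => -[e_sym _] _ _; rewrite e_sym.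
have n1 : (1 < n)%N by apply: leq_trans hn.
have di1 : 1 <= (degree e i)%:R :> R by rewrite ler1n (degree_gt0 hij).
have dj1 : 1 <= (degree e j)%:R :> R by rewrite ler1n (degree_gt0 eji).
have or_lly alpha : 0 <= alpha -> alpha < 1 ->
    (1 - alpha) / (degree e i)%:R + (1 - alpha) / (degree e j)%:R <= 1 ->
    kappa_or e alpha i j = (1 - alpha) * kappa_lly R e i j.
  by move=> *; rewrite kappa_lly_edge // kappa_or_edge.
have lly := @kappa_lly_edge R n e he i j hij.
have n2 : 2 < n%:R :> R by rewrite (ltr_nat R 2).
have n_ratio : 1 <= n%:R / (n%:R - 1) :> R by rewrite ler_pdivlMr; lra.
split.
  rewrite /is_leaf_edge negb_or /is_leaf => /andP[li lj] alpha a0 a1.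
  have di2 : 2 <= (degree e i)%:R :> R.
    by rewrite (ler_nat R 2) ltn_neqAle eq_sym li (degree_gt0 hij).
  have dj2 : 2 <= (degree e j)%:R :> R.
    by rewrite (ler_nat R 2) ltn_neqAle eq_sym lj (degree_gt0 eji).
  have half d : 2 <= d -> d^-1 <= 1 / 2 :> R.
    by move=> d2; rewrite -[d^-1]div1r ler_pdivrMr; lra.
  have hi := half _ di2; have hj := half _ dj2.
  have lly0 : kappa_lly R e i j <= 0 by rewrite lly; lra.
  rewrite or_lly //; last by nra.
  split; [by nra|by nra|].
  (* As 2 - deg x <= 0, replacing n / (n - 1) by 1 can only increase
     kappa_s x. *)
  have steinerberger x : 2 <= (degree e x)%:R :> R ->
      4 / (degree e x)%:R * (kappa_s R e x 0 - 1 / 2)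
        <= 6 * (degree e x)%:R^-1 - 4.
    move=> dx2; rewrite kappa_s_tree //.
    apply: (@le_trans _ _
      (4 / (degree e x)%:R * (2 - (degree e x)%:R - 1 / 2))).
      by rewrite ler_wpM2l ?divr_ge0 //; nra.
    by rewrite le_eqVlt; apply/orP; left; apply/eqP; field; lra.
  have inv0 d : 2 <= d -> 0 < d^-1 :> R by move=> d2; rewrite invr_gt0; lra.
  have := inv0 _ di2; have := inv0 _ dj2.
  rewrite gt_max lly => dj0 di0; apply/andP; split.
    by apply: le_lt_trans (steinerberger i di2) _; lra.
  by apply: le_lt_trans (steinerberger j dj2) _; lra.
rewrite /is_leaf => /eqP li alpha a0 a1.
have dj0 : 0 < (degree e j)%:R^-1 :> R by rewrite invr_gt0; lra.
have djV1 : (degree e j)%:R^-1 <= 1 :> R by rewrite invf_le1; lra.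
have b0 : 0 < 1 - alpha by lra.
split=> [a2|cond].
  by rewrite ler_pdivlMr //; nra.
have pq : (1 - alpha) / (degree e i)%:R + (1 - alpha) / (degree e j)%:R <= 1.
  by move: cond; rewrite li ler_pdivlMr //; nra.
have lly' : kappa_lly R e i j = 2 / (degree e j)%:R.
  by rewrite lly li; field; lra.
rewrite or_lly // lly' kappa_s_tree // li; split; nra.
Qed.
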